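(* Let $d$ be a bounded and continuous distance on $\mathcal{S}^{q-1}$ and let $H$ be a probability distribution on $\mathcal{S}^{q-1}$. Assume that the deepest point $\theta_d(H)$ is unique. Denote by $H_n$ the empirical distribution associated with a random sample of size $n$ from $H$, and let $\theta_d(H_n)$ be an arbitrary deepest point with respect to $H_n$. Then $\theta_d(H_n)\to\theta_d(H)$ almost surely as $n\to\infty$.
   Context: Let $q\ge 2$ and $\mathcal{S}^{q-1}=\{x\in\mathbb{R}^q: x'x=1\}$, where $'$ denotes transpose. A distance $d$ on $\mathcal{S}^{q-1}$ is a metric on this set; continuity of $d$, and convergence of deepest points, are with respect to the usual (Euclidean) topology. For a bounded distance $d$ put $d^{\rm sup}=\sup\{d(\theta,\psi):\theta,\psi\in\mathcal{S}^{q-1}\}$. For a (Borel probability) distribution $H$ on $\mathcal{S}^{q-1}$, the directional $d$-depth of $\theta\in\mathcal{S}^{q-1}$ with respect to $H$ is $D_d(\theta,H)=d^{\rm sup}-E_H[d(\theta,W)]$, where $E_H$ is expectation when $W$ has distribution $H$. A deepest point $\theta_d(H)$ with respect to $H$ is any maximizer of $\theta\mapsto D_d(\theta,H)$ over $\mathcal{S}^{q-1}$. The empirical distribution $H_n$ is that of the first $n$ terms $W_1,\dots,W_n$ of a sequence of i.i.d. random vectors with distribution $H$, so that $D_d(\theta,H_n)=d^{\rm sup}-\frac1n\sum_{i=1}^n d(\theta,W_i)$. *)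

(* Defs.v *)
From HB Require Import structures.
From mathcomp Require Import all_boot all_order all_algebra finmap.
From mathcomp Require Import all_classical all_reals all_analysis measurable_realfun.

Set Implicit Arguments.
Unset Strict Implicit.
Unset Printing Implicit Defensive.

Import Order.TTheory GRing.Theory Num.Theory.
Import numFieldNormedType.Exports.

Local Open Scope classical_set_scope.
Local Open Scope ring_scope.

Definition unit_sphere (R : realType) (q : nat) : set 'cV[R]_q :=
  [set x | x^T *m x = 1%:M].
Arguments unit_sphere R q : clear implicits.

Lemma unit_sphere_neq0 (R : realType) (q : nat) :
  (2 <= q)%N -> exists x : 'cV[R]_q, x \in unit_sphere R q.
Proof.
case: q => // q _; exists (delta_mx ord0 ord0); apply/mem_set.
rewrite /unit_sphere /= trmx_delta mul_delta_mx.
by apply/matrixP => i j; rewrite !mxE !ord1.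
Qed.

(* The bound on q is an argument of the type because measurable types are
   pointed: the proof is used only to exhibit a point. *)
Definition sphere (R : realType) (q : nat) (hq : (2 <= q)%N) : Type :=
  set_type (unit_sphere R q).

Section sphere_instances.
Variables (R : realType) (q : nat) (hq : (2 <= q)%N).

(* The norm of 'cV[R]_q is the sup norm, but its topology, hence the subspace
   topology used here, is the Euclidean one. *)
HB.instance Definition _ := PseudoMetric.copy (sphere R hq)
  (set_type (unit_sphere R q)).

HB.instance Definition _ := isPointed.Build (sphere R hq)
  (exist (fun x => x \in unit_sphere R q) _ (xchooseP (unit_sphere_neq0 R hq))).

HB.instance Definition _ := Measurable.copy (sphere R hq)
  (g_sigma_algebraType (@open (sphere R hq))).

End sphere_instances.

Record is_distance (R : realType) (T : Type) (d : T -> T -> R) : Prop := {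
  distance_ge0 : forall x y, 0 <= d x y ;
  distance_eq0 : forall x y, d x y = 0 <-> x = y ;
  distance_sym : forall x y, d x y = d y x ;
  distance_triangle : forall x y z, d x z <= d x y + d y z }.

Definition bounded_distance (R : realType) (T : Type) (d : T -> T -> R) : Prop :=
  exists M : R, forall x y, d x y <= M.

Definition distance_sup (R : realType) (T : Type) (d : T -> T -> R) : R :=
  sup [set d x y | x in [set: T] & y in [set: T]].

Section depth.
Context (R : realType) (disp : measure_display) (T : measurableType disp).
Variables (d : T -> T -> R) (H : probability T R).

Definition depth (theta : T) : \bar R :=
  ((distance_sup d)%:E - 'E_H[d theta])%E.

Definition deepest (theta : T) : Prop :=
  forall psi : T, (depth psi <= depth theta)%E.

End depth.

Section empirical.
Context (R : realType) (disp : measure_display) (T : measurableType disp).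
Variables (x : nat -> T).

(* The empirical distribution of x 0, ..., x n.-1; it is the zero measure if
   n = 0, hence a probability only for indices of the form n.+1. *)
Definition empirical (n : nat) : set T -> \bar R :=
  mscale (n%:R^-1)%:nng (msum (fun i => \d_(x i)) n).

HB.instance Definition _ (n : nat) := Measure.on (empirical n).

Let empirical_setT (n : nat) : empirical n.+1 [set: T] = 1%E.
Proof.
rewrite /empirical /mscale /= /msum.
rewrite (eq_bigr (fun=> 1%:E)) => [|i _]; last exact: diracT.
by rewrite sumEFin sumr_const card_ord -EFinM mulVf.
Qed.

HB.instance Definition _ (n : nat) :=
  Measure_isProbability.Build _ _ _ (empirical n.+1) (empirical_setT n).

End empirical.
Arguments empirical {R disp T} x n.

Section iid.
Context (R : realType) (dO : measure_display) (Omega : measurableType dO).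
Context (disp : measure_display) (T : measurableType disp).
Variables (P : probability Omega R) (W : nat -> {RV P >-> T}).

Definition mutually_independent : Prop :=
  forall (J : {fset nat}) (A : nat -> set T),
    (forall i, measurable (A i)) ->
    P (\bigcap_(i in [set` J]) (W i @^-1` A i)) =
    (\prod_(i <- J) P (W i @^-1` A i))%E.

Definition identically_distributed (H : probability T R) : Prop :=
  forall (i : nat) (A : set T), measurable A -> distribution P (W i) A = H A.

End iid.

Lemma depth_empirical (R : realType) (disp : measure_display)
    (T : measurableType disp) (d : T -> T -> R) (x : nat -> T) (n : nat)
    (theta : T) :
  is_distance d -> measurable_fun setT (d theta) ->
  depth d (empirical x n.+1) theta =
  (distance_sup d - n.+1%:R^-1 * \sum_(i < n.+1) d theta (x i))%:E.
Proof.
move=> dd md; rewrite /depth unlock EFinB; congr (_ - _)%E.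
have dge0 y : (setT : set T) y -> (0%R <= (d theta y)%:E)%E.
  by move=> _; rewrite lee_fin; exact: distance_ge0.
have mdE : measurable_fun setT (EFin \o d theta).
  exact/measurable_EFinP.
rewrite (ge0_integral_mscale (msum (fun i => \d_(x i)) n.+1)) //=.
rewrite ge0_integral_measure_sum // EFinM; congr (_ * _)%E.
rewrite -sumEFin; apply: eq_bigr => i _.
by rewrite integral_dirac // diracT mul1e.
Qed.

(* Main.v *)
Require Import Defs.
From HB Require Import structures.
From mathcomp Require Import all_boot all_order all_algebra finmap.
From mathcomp Require Import all_classical all_reals all_analysis measurable_realfun.
From mathcomp Require Import zify ring lra.
Import Order.TTheory GRing.Theory Num.Theory.
Import numFieldNormedType.Exports.
Local Open Scope classical_set_scope.
Local Open Scope ring_scope.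

(** A point [theta] is deepest exactly when it minimizes the mean distance
    [F theta = E_H d(theta, W)], and deepest for the sample when it minimizes
    the sample mean [Fn theta] of [d(theta, W_i)].  The statement is therefore
    a consistency result for minimizers, with two ingredients.

    The first is the strong law of large numbers at one point [theta]
    ([slln_bounded]).  Since [d] is bounded, second moments suffice: the
    centred variables are uncorrelated, so the mean of the first [n] of them
    has second moment at most [M^2 / n].  Along the squares [n = k^2] these
    bounds are summable, which forces almost sure convergence
    ([slln_along_squares]); boundedness of the terms then controls the means
    between consecutive squares ([cesaro_squares]).

    The second is a passage from one point to all points.  By the triangle
    inequality both [F] and [Fn] are 1-Lipschitz for [d] itself, whatever the
    sample.  If [t <> theta0], uniqueness gives a gap [F t - F theta0 > 0], so
    almost surely and eventually no point whose [d]-distance to [t] is below a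
    third of the gap can do as well as [theta0] on the sample; by continuity of
    [d] these points form a neighbourhood of [t].  The sphere is compact, so
    finitely many such neighbourhoods, together with a given neighbourhood [U]
    of [theta0], cover it.  Hence almost surely the sample minimizer is
    eventually in [U], and letting [U] run through countably many balls gives
    convergence. *)

(** * Averages along squares *)

Lemma floor_sqrt (n : nat) : exists m, (m ^ 2 <= n < m.+1 ^ 2)%N.
Proof.
elim: n => [|n [m /andP[le_mn lt_nm]]]; first by exists 0%N.
have [lt_n1m|le_mn1] := ltnP n.+1 (m.+1 ^ 2).
  by exists m; rewrite lt_n1m (leq_trans le_mn).
exists m.+1; rewrite le_mn1 /=.
by apply: leq_ltn_trans lt_nm _; rewrite ltn_exp2r.
Qed.

(** If [m^2 <= n < (m + 1)^2], at most [2 m] terms separate the [n]-th partial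
    sum from the [m^2]-th one, and they contribute at most [2 M / m] to the
    mean: convergence along squares gives convergence. *)
Lemma cesaro_squares (R : realType) (x : nat -> R) (M : R) :
  (forall i, `|x i| <= M) ->
  ((k.+1 ^ 2)%:R^-1 * \sum_(i < k.+1 ^ 2) x i) @[k --> \oo] --> 0 ->
  (n%:R^-1 * \sum_(i < n) x i) @[n --> \oo] --> 0.
Proof.
move=> xM squares0; have M0 : 0 <= M by apply: le_trans (xM 0%N).
pose S n := \sum_(i < n) x i.
have Sle m n : (m <= n)%N -> `|S n| <= `|S m| + M * (n - m)%:R.
  move=> le_mn; rewrite /S -!(big_mkord xpredT) (big_cat_nat (n := m)) //=.
  apply: le_trans (ler_normD _ _) _; rewrite lerD2l.
  apply: le_trans (ler_norm_sum _ _ _) _.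
  apply: le_trans (ler_sum _ (fun i _ => xM i)) _.
  by rewrite sumr_const_nat mulr_natr.
apply/cvgrPdist_lt => e e0.
move/cvgrPdist_lt : squares0 => /(_ (e / 2)) [|K _ KP].
  by rewrite divr_gt0.
have [L LP] : exists L : nat, 2 * M / (e / 2) < L%:R.
  by exists (Num.bound (2 * M / (e / 2))); apply: archi_boundP;
    rewrite divr_ge0 ?mulr_ge0 // ltW // divr_gt0.
(* Beyond this index the square root m is so large that the mean of the first
   m ^ 2 terms and the interpolation error 2 M / m are both below e / 2. *)
near=> n; rewrite sub0r normrN.
have [m /andP[le_mn lt_nm]] := floor_sqrt n.
have mKL : ((K + L).+1 <= m)%N.
  rewrite leqNgt ltnS; apply/negP => le_m.
  have : (n < (K + L).+1 ^ 2)%N.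
    by apply: leq_trans lt_nm _; rewrite leq_exp2r.
  by apply/negP; rewrite -leqNgt; near: n; exists ((K + L).+1 ^ 2)%N.
have m0 : (0 < m)%N by apply: leq_trans mKL.
have n0 : (0 < n)%N by apply: leq_trans le_mn; rewrite expn_gt0 m0.
have mR0 : 0 < m%:R :> R by rewrite ltr0n.
have m2R0 : 0 < (m ^ 2)%:R :> R by rewrite ltr0n expn_gt0 m0.
have nR0 : 0 < n%:R :> R by rewrite ltr0n.
rewrite normrM ger0_norm ?invr_ge0 ?ler0n // -/(S n).
apply: (@le_lt_trans _ _ (`|S (m ^ 2)%N| / (m ^ 2)%:R + 2 * M / m%:R)).
  have : n%:R^-1 * `|S n| <= (m ^ 2)%:R^-1 * (`|S (m ^ 2)%N| + M * (2 * m)%:R).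
    apply: ler_pM; rewrite ?invr_ge0 ?ler0n //.
      by rewrite lef_pV2 ?posrE // ler_nat.
    apply: le_trans (Sle _ _ le_mn) _; rewrite lerD2l ler_wpM2l // ler_nat.
    by move: lt_nm le_mn; rewrite -!mulnn; nia.
  move=> /le_trans; apply; rewrite natrX natrM le_eqVlt; apply/orP; left.
  by apply/eqP; field; rewrite gt_eqF.
rewrite [ltRHS](splitr e); apply: ltrD.
  have /KP : (K <= m.-1)%N by lia.
  by rewrite sub0r normrN prednK // normrM ger0_norm ?invr_ge0 ?ler0n // mulrC.
rewrite ltr_pdivrMr // [ltRHS]mulrC -ltr_pdivrMr ?divr_gt0 //.
by apply: lt_le_trans LP _; rewrite ler_nat; lia.
Unshelve. all: end_near. Qed.

(** Telescoping, from [1 / (k + 1)^2 <= 2 / (k + 1) - 2 / (k + 2)]. *)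
Lemma sum_inv_squares_le (R : realType) (n : nat) :
  \sum_(k < n) (k.+1%:R ^- 2) <= 2 - 2 / n.+1%:R :> R.
Proof.
elim: n => [|n ih]; first by rewrite big_ord0 divr1 subrr.
rewrite big_ord_recr /=.
have n1 : 0 < n.+1%:R :> R by rewrite ltr0n.
have n2 : 0 < n.+2%:R :> R by rewrite ltr0n.
have E : 2 / n.+1%:R - 2 / n.+2%:R = 2 / (n.+1%:R * n.+2%:R) :> R.
  by rewrite -[n.+2]addn1 natrD in n2 *; field; rewrite !gt_eqF.
have : n.+1%:R ^- 2 <= 2 / (n.+1%:R * n.+2%:R) :> R.
  rewrite ler_pdivlMr ?mulr_gt0 // mulrC expr2 -mulf_div divff ?gt_eqF // mul1r.
  by rewrite ler_pdivrMr // -natrM ler_nat; lia.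
by rewrite -E => /(lerD ih) /le_trans; apply; rewrite addrA subrK.
Qed.

(** * Strong law of large numbers for bounded variables *)

Section bounded_uncorrelated.
Context d (Omega : measurableType d) (R : realType) (P : probability Omega R).

Lemma bounded_integrable (f : Omega -> R) (M : R) :
  measurable_fun setT f -> (forall w, `|f w| <= M) ->
  P.-integrable setT (EFin \o f).
Proof.
move=> mf fM; apply: measurable_bounded_integrable => //.
  exact: le_lt_trans (probability_le1 P measurableT) (ltry 1).
exists M; split; first exact: num_real.
by move=> K MK w _; apply: le_trans (fM w) (ltW MK).
Qed.

Variables (X : nat -> Omega -> R) (M : R).
Hypothesis X_measurable : forall i, measurable_fun setT (X i).
Hypothesis X_bounded : forall i w, `|X i w| <= M.
Hypothesis X_uncorrelated :
  forall i j, i <> j -> (\int[P]_w (X i w * X j w)%:E = 0)%E.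

Let XX_bounded i j w : `|X i w * X j w| <= M ^+ 2.
Proof. by rewrite normrM expr2 ler_pM. Qed.

Let XX_integrable i j : P.-integrable setT (fun w => (X i w * X j w)%:E).
Proof.
apply: (@bounded_integrable (X i \* X j) (M ^+ 2)).
  exact: measurable_funM.
exact: XX_bounded.
Qed.

(** Only the diagonal of the double sum survives integration. *)
Lemma second_moment_sum_le (n : nat) :
  (\int[P]_w ((\sum_(i < n) X i w) ^+ 2)%:E <= (n%:R * M ^+ 2)%:E)%E.
Proof.
under eq_integral => w _ do rewrite expr2 big_distrlr /= -sumEFin.
rewrite integral_sum //; last first.
  move=> i; under eq_fun do rewrite -sumEFin.
  exact: integrable_sum.
rewrite mulr_natl -[n in leRHS]card_ord -sumr_const -sumEFin.
apply: lee_sum => i _.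
under eq_integral do rewrite -sumEFin.
rewrite integral_sum // (bigD1 i) //= big1 => [|j ji]; last first.
  by apply: X_uncorrelated => ij; case/eqP: ji; apply: val_inj.
rewrite adde0 -[leRHS]mule1 -(@probability_setT _ _ _ P) -integral_cst //.
apply: le_integral => //; last first.
  move=> w _; rewrite lee_fin.
  exact: le_trans (ler_norm _) (XX_bounded _ _ _).
exact: finite_measure_integrable_cst.
Qed.

(** The squares of the means along [n = (k + 1)^2] have integrals bounded by
    [M^2 / (k + 1)^2].  Their sum is thus integrable, hence almost surely
    finite, and the terms of a convergent series tend to zero. *)
Lemma slln_along_squares :
  {ae P, forall w, ((k.+1 ^ 2)%:R^-1 * \sum_(i < k.+1 ^ 2) X i w)
                     @[k --> \oo] --> 0}.
Proof.
pose S n w := \sum_(i < n) X i w.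
pose Y k w := ((k.+1 ^ 2)%:R^-1 * S (k.+1 ^ 2)%N w) ^+ 2.
have mS n : measurable_fun setT (S n).
  by apply: measurable_sum => i; exact: X_measurable.
have mY k : measurable_fun setT (fun w => (Y k w)%:E).
  by apply/measurable_EFinP; apply: measurable_funX; exact: measurable_funM.
have Y0 k w : (0 <= (Y k w)%:E)%E by rewrite lee_fin sqr_ge0.
have EY k : (\int[P]_w (Y k w)%:E <= (M ^+ 2 * k.+1%:R ^- 2)%:E)%E.
  under eq_integral do rewrite /Y exprMn EFinM.
  rewrite ge0_integralZl_EFin //; last 2 first.
  - by move=> w _; rewrite lee_fin sqr_ge0.
  - by apply/measurable_EFinP; exact: measurable_funX.
  apply: le_trans (lee_wpmul2l _ (second_moment_sum_le _)) _.
    by rewrite lee_fin sqr_ge0.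
  rewrite -EFinM lee_fin natrX le_eqVlt; apply/orP; left; apply/eqP.
  have : k.+1%:R != 0 :> R by rewrite pnatr_eq0.
  by move: k.+1%:R => a a0; field.
have intY : (\int[P]_w (\sum_(0 <= k <oo) (Y k w)%:E) < +oo)%E.
  rewrite integral_nneseries //.
  apply: (@le_lt_trans _ _ (M ^+ 2 * 2)%:E); last exact: ltry.
  apply: lime_le.
    by apply: is_cvg_nneseries => k _ _; exact: integral_ge0.
  apply: nearW => n.
  apply: le_trans (lee_sum _ (fun k _ => EY k)) _.
  rewrite sumEFin lee_fin big_mkord -mulr_sumr ler_wpM2l ?sqr_ge0 //.
  apply: le_trans (sum_inv_squares_le R n) _.
  by rewrite gerBl divr_ge0.
have : P.-integrable setT (fun w => (\sum_(0 <= k <oo) (Y k w)%:E)%E).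
  apply/integrableP; split.
    exact: (@ge0_emeasurable_sum _ _ _ _ (fun k w => (Y k w)%:E) xpredT).
  under eq_integral do rewrite gee0_abs ?nneseries_ge0 //.
  exact: intY.
move=> /(integrable_ae measurableT); apply: filterS => w /(_ I) finY.
have Y_cvg0 : Y k w @[k --> \oo] --> 0.
  apply: cvg_series_cvg_0; apply: nnseries_is_cvg.
    by move=> k; exact: sqr_ge0.
  by rewrite -ge0_fin_numE // nneseries_ge0.
apply/cvgrPdist_lt => e e0.
move/cvgrPdist_lt : Y_cvg0 => /(_ (e ^+ 2)) [|K _ KP].
  by rewrite exprn_gt0.
exists K => // k /KP; rewrite !sub0r !normrN normrX.
by rewrite ltr_pXn2r // nnegrE ltW.
Qed.

Lemma slln_bounded_uncorrelated :
  {ae P, forall w, (n%:R^-1 * \sum_(i < n) X i w) @[n --> \oo] --> 0}.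
Proof.
have := slln_along_squares; apply: filterS => w.
exact: (cesaro_squares R (X ^~ w) M (X_bounded ^~ w)).
Qed.
End bounded_uncorrelated.

(** As [W i] and [W j] are independent with law [H], the pair
    [(W i, W j)] has law [H \x H]: both measures agree on rectangles.  Fubini
    then makes the expectation of the product vanish. *)
Lemma bounded_iid_uncorrelated d (Omega : measurableType d)
    d' (T : measurableType d') (R : realType) (P : probability Omega R) (H : probability T R)
    (W : nat -> {RV P >-> T}) (f : T -> R) (M : R) :
  mutually_independent W -> identically_distributed W H ->
  measurable_fun setT f -> (forall x, `|f x| <= M) ->
  (\int[H]_x (f x)%:E = 0)%E ->
  forall i j, i <> j -> (\int[P]_w (f (W i w) * f (W j w))%:E = 0)%E.
Proof.
move=> indepW idW mf fM f0 i j ij.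
have mWW : measurable_fun setT (fun w => (W i w, W j w)).
  exact: measurable_fun_pair.
pose WW : {RV P >-> (T * T)%type} := HB.pack (fun w => (W i w, W j w))
  (isMeasurableFun.Build _ _ _ _ _ mWW).
pose g (p : T * T) : R := f p.1 * f p.2.
have mg : measurable_fun setT (EFin \o g).
  apply/measurable_EFinP; apply: measurable_funM.
    exact: measurableT_comp.
  exact: measurableT_comp.
have gM p : `|g p| <= M ^+ 2 by rewrite normrM expr2 ler_pM.
have lawWW (X : set (T * T)) : measurable X ->
    (H \x H)%E X = distribution P WW X.
  apply: product_measure_unique => A B mA mB.
  pose C k := if k == i then A else B.
  have mC k : measurable (C k) by rewrite /C; case: ifP.
  have := indepW [fset i; j]%fset C mC.
  have ijF : (i \in [fset j]%fset) = false.
    by apply/negbTE; rewrite inE; apply/eqP.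
  rewrite big_fsetU1 ?ijF //= big_seq_fset1 /C eqxx.
  have /negbTE -> : j != i by apply/eqP => ji; exact: ij.
  have idE k D : measurable D -> P (W k @^-1` D) = H D.
    by move=> mD; rewrite -(idW k).
  rewrite !idE // => <-; congr (P _).
  apply/seteqP; split => w /=.
    by move=> [Aw Bw] k /=; rewrite in_fset2 => /orP[]/eqP ->; rewrite ?eqxx //;
       case: eqP => // ji; case: ij.
  move=> CW; split.
    by have := CW i; rewrite eqxx /=; apply; rewrite /= in_fset2 eqxx.
  have := CW j; case: eqP => [ji|_]; first by case: ij.
  by apply; rewrite /= in_fset2 eqxx orbT.
have -> : (\int[P]_w (f (W i w) * f (W j w))%:E =
           \int[distribution P WW]_p (g p)%:E)%E.
  rewrite integral_distribution //.
  apply: (@bounded_integrable _ _ _ _ (g \o WW) (M ^+ 2)) => //.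
    apply: measurableT_comp => //; exact/measurable_EFinP.
  by move=> w; exact: gM.
have int_g : (H \x H)%E.-integrable setT (EFin \o g).
  have /integrableP[_] :=
    bounded_integrable _ _ _ (distribution P WW) g _
      ((measurable_EFinP _ _).1 mg) gM.
  rewrite -(eq_measure_integral (distribution P WW) (m1 := (H \x H)%E)).
    by move=> g_fin; apply/integrableP.
  by move=> X mX _; exact: lawWW.
rewrite -(eq_measure_integral (distribution P WW) (m1 := (H \x H)%E)) //;
  last by move=> X mX _; exact: lawWW.
have int_f : H.-integrable setT (EFin \o f).
  exact: (bounded_integrable _ _ _ H f M).
(* The inner integral is [f x] times the integral of [f], which is zero. *)
rewrite -integral12_prod_meas1 /fubini_F /g /=.
  under eq_integral => x _.
    under eq_integral do rewrite EFinM.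
    rewrite integralZl // f0 mule0; over.
  exact: integral0.
exact: int_g.
Qed.

Lemma slln_bounded d (Omega : measurableType d) d' (T : measurableType d')
    (R : realType) (P : probability Omega R) (H : probability T R)
    (W : nat -> {RV P >-> T}) (f : T -> R) (M : R) :
  mutually_independent W -> identically_distributed W H ->
  measurable_fun setT f -> (forall x, `|f x| <= M) ->
  {ae P, forall w, (n%:R^-1 * \sum_(i < n) f (W i w)) @[n --> \oo]
                     --> fine (\int[H]_x (f x)%:E)}.
Proof.
move=> indepW idW mf fM.
have int_f : H.-integrable setT (EFin \o f).
  exact: (bounded_integrable _ _ _ H f M).
set mu := fine _.
pose g x := f x - mu.
have mg : measurable_fun setT g by exact: measurable_funB.
have gM x : `|g x| <= M + `|mu|.
  by apply: le_trans (ler_normB _ _) _; rewrite lerD2r.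
have g0 : (\int[H]_x (g x)%:E = 0)%E.
  under eq_integral do rewrite EFinB.
  rewrite integralB_EFin //; last exact: finite_measure_integrable_cst.
  have -> : (\int[H]_x mu%:E = mu%:E)%E.
    by rewrite -[RHS]mule1 -(@probability_setT _ _ _ H) integral_cst.
  rewrite fineK ?subee //.
    exact: integrable_fin_num.
  exact: integrable_fin_num.
have := slln_bounded_uncorrelated _ _ R P (fun i w => g (W i w)) (M + `|mu|)
  (fun i => measurableT_comp mg (measurable_funPT (W i)))
  (fun i w => gM (W i w))
  (bounded_iid_uncorrelated _ _ _ _ _ P H W g _ indepW idW mg gM g0).
apply: filterS => w cvg_g.
apply/cvgrPdist_lt => e e0.
move/cvgrPdist_lt : cvg_g => /(_ e e0) [K _ KP].
exists (maxn K 1) => // n /=; rewrite geq_max => /andP[/KP + n0].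
rewrite sub0r normrN sumrB sumr_const card_ord mulrBr -[mu *+ n]mulr_natl.
rewrite mulKf 1?distrC //.
by rewrite pnatr_eq0 -lt0n.
Qed.

(** * Topology of the sphere *)

Lemma compact_unit_sphere (R : realType) (q : nat) : compact (unit_sphere R q).
Proof.
have sphereE : unit_sphere R q =
    trmx @` [set x : 'rV[R]_q | \sum_i x 0 i ^+ 2 = 1].
  apply/seteqP; split => x /=.
    move=> xx; exists x^T; last by rewrite trmxK.
    have /matrixP/(_ 0 0) := xx; rewrite !mxE eqxx mulr1n => <-.
    by apply: eq_bigr => i _; rewrite !mxE expr2.
  move=> [y yy <-]; rewrite /unit_sphere /= trmxK.
  apply/matrixP => i j; rewrite !ord1 !mxE eqxx mulr1n -yy.
  by apply: eq_bigr => k _; rewrite !mxE expr2.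
rewrite sphereE; apply: continuous_compact.
  apply: continuous_subspaceT => x U /= /nbhs_ballP [e e0 eU].
  apply/nbhs_ballP; exists e => // y [_ xy]; apply: eU; split => // i j.
  by rewrite !mxE; exact: xy.
apply: bounded_closed_compact.
  exists 1; split => // K K1 x /= xx; rewrite /Num.norm /= mx_normrE.
  apply/bigmax_leP; split; first by apply: ltW; apply: le_lt_trans K1.
  move=> [i j] _ /=; rewrite (ord1 i); apply: le_trans (ltW K1).
  rewrite -(@ler_pXn2r _ 2) ?nnegrE // expr1n -normrX ger0_norm ?sqr_ge0 //.
  rewrite -xx (bigD1 j) //= lerDl.
  by apply: sumr_ge0 => k _; exact: sqr_ge0.
pose sumsq (x : 'rV[R]_q) := \sum_i x 0 i ^+ 2.
have cont_sumsq : continuous sumsq.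
  apply: continuous_big => [|i _ x]; first exact: add_continuous.
  apply: (@continuous_comp _ _ _ (fun y : 'rV[R]_q => y 0 i) (fun a => a ^+ 2)).
    exact: coord_continuous.
  exact: exprn_continuous.
rewrite (_ : [set x | _] = sumsq @^-1` [set 1]) //.
apply: preimage_closed => [x _|]; first exact: cont_sumsq.
exact/accessible_closed_set1/hausdorff_accessible/Rhausdorff.
Qed.

(** Neighbourhoods in the subtype are traces of neighbourhoods in the ambient
    space, so the covering property that characterizes compactness is
    inherited by predicates that quantify over the proof of membership. *)
Lemma compact_sphere (R : realType) (q : nat) (hq : (2 <= q)%N) :
  compact [set: sphere R hq].
Proof.
apply/compact_near_coveringP => J F Q FF cover.
have /compact_near_coveringP near_sphere := compact_unit_sphere R q.
pose Q' i x := forall h : x \in unit_sphere R q, Q i (exist _ x h).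
have : \near F, unit_sphere R q `<=` Q' F.
  apply: near_sphere => x xS.
  have [[U V] [/= /nbhs_ballP[e e0 eU] FV] UVQ] :=
    cover (exist _ x (mem_set xS)) I.
  exists (ball x e, V) => /=; first by split => //; exact: nbhsx_ballx.
  move=> [y i] /= [xy Vi] h; apply: (UVQ (exist _ y h, i)).
  by split => //; exact: eU.
by apply: filterS => i Q'i [x xS] _; exact: Q'i (set_mem xS) _.
Qed.

Lemma continuous_measurable_sphere (R : realType) (q : nat) (hq : (2 <= q)%N)
  (f : sphere R hq -> R) : continuous f -> measurable_fun setT f.
Proof.
move=> /continuousP cf.
apply: (measurability _ (RGenOpens.measurableE R)) => //.
move=> _ [_ [a [b ->] <-]].
apply: measurableI => //; apply: sub_sigma_algebra.
by apply: cf; exact: interval_open.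
Qed.

(** * Almost sure eventual properties and sample minimizers *)

(** This family of sets of pairs (sample size, outcome) is a filter; compactness
    can be applied with respect to it, so that one null set and one rank serve
    all points of the sphere. *)
Definition ae_eventually d (Omega : measurableType d) (R : realType)
    (P : probability Omega R) : set_system (nat * Omega) :=
  [set A | {ae P, forall w, \forall n \near \oo, A (n, w)}].

Lemma ae_eventually_filter d (Omega : measurableType d) (R : realType)
  (P : probability Omega R) : Filter (ae_eventually _ _ R P).
Proof.
rewrite /ae_eventually; split=> /= [|A B|A B AB].
- by apply: aeW => w; apply: nearW.
- move=> aeA aeB; have := @filterI _ _ (ae_filter_ringOfSetsType P) _ _ aeA aeB.
  apply: (@filterS _ _ (ae_filter_ringOfSetsType P)) => w [/= An Bn].
  exact: filterI.
- apply: (@filterS _ _ (ae_filter_ringOfSetsType P)) => w.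
  by apply: filterS => n; exact: AB.
Qed.

Lemma bounded_distance_norm (R : realType) (T : Type) (d : T -> T -> R) :
  is_distance d -> bounded_distance d -> exists M, forall x y, `|d x y| <= M.
Proof.
move=> dd [M dM]; exists M => x y.
by rewrite ger0_norm //; exact: distance_ge0.
Qed.

Section mean_distance.
Context disp (T : measurableType disp) (R : realType) (H : probability T R).
Variable d : T -> T -> R.

Definition mean_distance (theta : T) : R := fine (\int[H]_x (d theta x)%:E).

Hypothesis d_distance : is_distance d.
Hypothesis d_bounded : bounded_distance d.
Hypothesis d_measurable : forall theta, measurable_fun setT (d theta).

Lemma depth_mean_distance (theta : T) :
  depth d H theta = (distance_sup d - mean_distance theta)%:E.
Proof.
have [M dM] := bounded_distance_norm _ _ d d_distance d_bounded.
rewrite /depth unlock EFinB fineK //.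
apply: integrable_fin_num => //.
exact: (bounded_integrable _ _ _ H (d theta) M).
Qed.

(** A point whose mean distance does not exceed that of [theta0] would be
    deepest as well. *)
Lemma unique_deepest_lt (theta0 : T) :
  deepest d H theta0 -> (forall theta, deepest d H theta -> theta = theta0) ->
  forall theta, theta <> theta0 -> mean_distance theta0 < mean_distance theta.
Proof.
move=> deep0 uniq0 theta ne; rewrite ltNge; apply/negP => le_mean.
apply: ne; apply: uniq0 => psi; apply: le_trans (deep0 psi) _.
by rewrite !depth_mean_distance lee_fin lerD2l lerN2.
Qed.
End mean_distance.

Lemma deepest_empirical_le (R : realType) disp (T : measurableType disp)
    (d : T -> T -> R) (x : nat -> T) (n : nat) (theta psi : T) :
  is_distance d -> (forall t, measurable_fun setT (d t)) ->
  deepest d (empirical x n.+1) theta ->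
  n.+1%:R^-1 * \sum_(i < n.+1) d theta (x i) <=
  n.+1%:R^-1 * \sum_(i < n.+1) d psi (x i).
Proof.
move=> dd md /(_ psi).
rewrite depth_empirical // depth_empirical //.
by rewrite lee_fin lerD2l lerN2.
Qed.

(** This uniform control over the sample, with constant 1 in the distance [d]
    itself, is what makes a law of large numbers at one point informative on a
    neighbourhood of that point. *)
Lemma sample_mean_distance_lipschitz (R : realType) (T : Type)
    (d : T -> T -> R) (x : nat -> T) (n : nat) (theta psi : T) :
  is_distance d ->
  n%:R^-1 * \sum_(i < n) d theta (x i) <=
  n%:R^-1 * \sum_(i < n) d psi (x i) + d theta psi.
Proof.
move=> dd; have [->|n0] := posnP n.
  by rewrite invr0 !mul0r add0r; exact: distance_ge0.
have nE : d theta psi = n%:R^-1 * \sum_(i < n) d theta psi.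
  rewrite sumr_const card_ord -[d _ _ *+ n]mulr_natl mulKf //.
  by rewrite pnatr_eq0 -lt0n.
rewrite [X in _ + X]nE -mulrDr -big_split /= ler_wpM2l ?invr_ge0 //.
by apply: ler_sum => i _; rewrite addrC; exact: distance_triangle.
Qed.

Lemma continuous_section (X Y Z : topologicalType) (f : X * Y -> Z) (x : X) :
  continuous f -> continuous (fun y => f (x, y)).
Proof.
move=> cf y; apply: (@continuous_comp _ _ _ (fun y => (x, y)) f);
  last exact: cf.
by apply: cvg_pair; [exact: cvg_cst|exact: cvg_id].
Qed.

(** * Consistency of the deepest point *)

Theorem theorem8 (R : realType) (q : nat) (hq : (2 <= q)%N)
  (d : sphere R hq -> sphere R hq -> R)
  (d_distance : is_distance d)
  (d_bounded : bounded_distance d)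
  (d_continuous : continuous (fun p : sphere R hq * sphere R hq => d p.1 p.2))
  (H : probability (sphere R hq) R)
  (theta0 : sphere R hq)
  (theta0_deepest : deepest d H theta0)
  (theta0_unique : forall theta : sphere R hq, deepest d H theta -> theta = theta0)
  (disp : measure_display) (Omega : measurableType disp) (P : probability Omega R)
  (W : nat -> {RV P >-> sphere R hq})
  (W_independent : mutually_independent W)
  (W_distribution : identically_distributed W H)
  (theta : nat -> Omega -> sphere R hq)
  (theta_deepest : forall (n : nat) (w : Omega),
     deepest d (empirical (fun i => W i w) n.+1) (theta n.+1 w)) :
  {ae P, forall w : Omega, theta n w @[n --> \oo] --> theta0}.
Proof.
have d_cont t : continuous (d t) by
  exact: (continuous_section _ _ _ _ t d_continuous).
have d_meas t : measurable_fun setT (d t).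
  exact: continuous_measurable_sphere.
have [M dM] := bounded_distance_norm _ _ d d_distance d_bounded.
pose F := mean_distance _ _ _ H d.
pose Fn n w t := n%:R^-1 * \sum_(i < n) d t (W i w).
have slln t : {ae P, forall w, Fn n w t @[n --> \oo] --> F t}.
  exact: (slln_bounded _ _ _ _ _ P H W (d t) M).
have minF t : t <> theta0 -> F theta0 < F t.
  exact: unique_deepest_lt.
have near_theta0 (U : set (sphere R hq)) : nbhs theta0 U ->
    {ae P, forall w, \forall n \near \oo, U (theta n w)}.
  move=> U0.
  pose Q (p : nat * Omega) t := U t \/ Fn p.1 p.2 theta0 < Fn p.1 p.2 t.
  (* Almost surely, for all large samples at once, every point outside U does
     strictly worse than theta0 on the sample. *)
  have : ae_eventually _ _ _ P (fun p => [set: sphere R hq] `<=` Q p).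
    have /compact_near_coveringP covering := compact_sphere R q hq.
    apply: (covering _ _ Q (ae_eventually_filter _ _ _ P)) => t _.
    have [->|/eqP ne] := eqVneq t theta0.
      exists (U, setT) => /=.
        split => //.
        exact: (@filterT _ _ (ae_eventually_filter _ _ _ _)).
      by move=> [s [n w]] [/= Us _]; left.
    (* One third of the gap between t and theta0 absorbs each of the three
       errors: at t, at theta0, and from t to its neighbours. *)
    pose delta := (F t - F theta0) / 3.
    have delta0 : 0 < delta by rewrite divr_gt0 // subr_gt0 minF.
    exists ([set s | d t s < delta],
            [set p | F t - delta < Fn p.1 p.2 t /\
                     Fn p.1 p.2 theta0 < F theta0 + delta]) => /=.
      split.
        have dtt : d t t = 0 by exact/(distance_eq0 d_distance).
        have /cvgrPdist_lt /(_ delta delta0) := d_cont t t.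
        rewrite dtt; apply: filterS => s; rewrite sub0r normrN.
        exact: le_lt_trans (ler_norm _).
      apply: filterS2 (slln t) (slln theta0) => w.
      move=> /cvgrPdist_lt/(_ _ delta0) near_t /cvgrPdist_lt/(_ _ delta0).
      apply: filterS2 near_t => n.
      rewrite !ltr_norml => /andP[_ lt_t] /andP[lt_0 _] /=; split; lra.
    move=> [s [n w]] [/= ts [lt_t lt_0]]; right => /=.
    have := sample_mean_distance_lipschitz
      _ _ d (fun i => W i w) n t s d_distance.
    rewrite -/(Fn n w t) -/(Fn n w s) /= in lt_t lt_0 *.
    rewrite /delta in ts lt_t lt_0 *; lra.
  rewrite /ae_eventually /=; apply: filterS => w [N _ NQ].
  (* theta 0 is unconstrained, so ranks start at one. *)
  exists N.+1 => // -[//|n] /= Nn.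
  have [//|] := NQ n.+1 (ltnW Nn) (theta n.+1 w) I.
  rewrite ltNge /Fn /=; have := theta_deepest n w.
  by move=> /(deepest_empirical_le _ _ _ _ _ _ _ theta0 d_distance d_meas) ->.
have : {ae P, forall w, forall k : nat,
    \forall n \near \oo, ball theta0 (k.+1%:R^-1 : R) (theta n w)}.
  apply: ae_foralln => k; apply: near_theta0.
  by apply: nbhsx_ballx; rewrite invr_gt0.
apply: filterS => w near_w U /nbhs_ballP[e /= e0 eU].
have [k _ /(_ _ (leqnn _)) ke] := near_infty_natSinv_lt (PosNum e0).
apply: filterS (near_w k) => n /= wn; apply: eU.
exact: le_ball (ltW ke) _ wn.
Qed.
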